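(* Let $(W,\|\cdot\|)$ be a complete normed linear space and let $W_0\subset W$ be a closed subspace. Let $T:W\to W$ be a (not necessarily linear) map with $(I-T)(W)\subseteq W_0$, and let $k\in U$ be such that for every $w\in W$ with $w-Tw\in W_0$, $$\|Tw-T^2w\|\le k(\|w-Tw\|)\,\|w-Tw\|.$$ If the function $h:W\to\mathbb{R}$, $h(u)=D(u,Tu)=\|u-Tu\|$, is lower semicontinuous, then for every $w\in W$ the limit $\lim_{n\to\infty}T^nw$ exists and $$\lim_{n\to\infty}T^nw\in\{w^*\in W: w^*=Tw^*\}\cap(w+W_0).$$
   Context: $U$ is the set of functions $k:[0,\infty)\to[0,1)$ such that $\limsup_{r\to t^+}k(r)<1$ for every $t\in[0,\infty)$. $I$ is the identity map on $W$, $T^n$ is the $n$-fold iterate of $T$, and $w+W_0=\{w+x:x\in W_0\}$. *)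

(* Defs.v *)
From HB Require Import structures.
From mathcomp Require Import all_boot all_order all_algebra.
From mathcomp Require Import all_classical all_reals all_analysis.

Set Implicit Arguments.
Unset Strict Implicit.
Unset Printing Implicit Defensive.

Import Order.TTheory GRing.Theory Num.Theory.
Import numFieldNormedType.Exports.

Local Open Scope classical_set_scope.
Local Open Scope ring_scope.

(* A function [0, +oo[ -> [0, 1[ is represented by a total function R -> R
   whose values on the negative reals are irrelevant: the filter t^'+ with
   0 <= t only sees r > t. This is the class U. *)
Definition U {R : realType} : set (R -> R) :=
  [set k : R -> R | (forall t : R, 0 <= t -> 0 <= k t < 1) /\
     (forall t : R, 0 <= t -> (limf_esup (EFin \o k) t^'+ < 1%:E)%E)].

(* Main.v *)
Require Import Defs.
From HB Require Import structures.
From mathcomp Require Import all_boot all_order all_algebra.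
From mathcomp Require Import all_classical all_reals all_analysis.

Set Implicit Arguments.
Unset Strict Implicit.
Unset Printing Implicit Defensive.

Import Order.TTheory GRing.Theory Num.Theory.
Import numFieldNormedType.Exports.

Local Open Scope classical_set_scope.
Local Open Scope ring_scope.

(* The displacements [a n = `|T^n w - T^n.+1 w|] satisfy
   [a n.+1 <= k (a n) * a n], so they decrease to some [t >= 0]. Since [k t < 1]
   and the right limsup of [k] at [t] is less than 1, [k] is bounded by some
   [q < 1] on [[t, t + e[]; hence the displacements eventually decay
   geometrically, [T^n w] is Cauchy, and lower semicontinuity forces the
   displacement of the limit to vanish. *)

Lemma U_right_bound (R : realType) (k : R -> R) (t : R) : U k -> 0 <= t ->
  exists q e : R, [/\ 0 <= q < 1, 0 < e & forall r, t <= r < t + e -> k r <= q].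
Proof.
move=> [k01 klim] t0; have /andP[kt0 kt1] := k01 _ t0.
move: (klim _ t0); rewrite limf_esupE => /ereal_inf_lt[_ [V Vt <-] supV].
have [s s1 ks] : exists2 s : R, s < 1 & forall r, V r -> k r <= s.
  have kV r : V r -> ((k r)%:E <= ereal_sup [set (EFin \o k) x | x in V])%E.
    by move=> Vr; apply: ereal_sup_ubound; exists r.
  move: supV kV; case: (ereal_sup _) => [s|//|] + kV.
  - by rewrite lte_fin => s1; exists s.
  (* A supremum of [-oo] forces [V] to be empty, so the bound 0 is arbitrary. *)
  - by move=> _; exists 0 => // r /kV.
(* The filter [t^'+] does not see [t] itself, so [s] only bounds [k] to the right of [t]. Taking the
   maximum with [k t] covers [r = t] and also gives [0 <= q]. *)
have [e /= e0 Ve] := Vt; exists (Num.max (k t) s), e; split=> //.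
- by rewrite le_max kt0 gt_max kt1 s1.
- move=> r /andP[]; rewrite le_eqVlt => /predU1P[<- _|tr rte].
    by rewrite le_max lexx.
  rewrite le_max ks ?orbT//; apply: Ve => //=.
  by rewrite ltr0_norm ?subr_lt0// opprB ltrBlDl.
Qed.

Lemma U_eventually_contracting (R : realType) (k : R -> R) (a : R^nat) :
  U k -> (forall n, 0 <= a n) -> (forall n, a n.+1 <= k (a n) * a n) ->
  exists q N, 0 <= q < 1 /\ forall n, (N <= n)%N -> a n.+1 <= q * a n.
Proof.
move=> Uk a0 ak.
have a_nincr : nonincreasing_seq a.
  apply/nonincreasing_seqP => n; apply: le_trans (ak n) _.
  by rewrite ler_piMl//; case: Uk => /(_ _ (a0 n)) /andP[_ /ltW].
have a_cvg : cvgn a.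
  by apply: nonincreasing_is_cvgn => //; exists 0 => _ [n _ <-].
have lima0 : 0 <= limn a by apply: limr_ge => //; exact: nearW.
have [q [e [q01 e0 kq]]] := U_right_bound Uk lima0.
have : \forall n \near \oo, a n < limn a + e.
  by apply: (cvgr_lt (limn a)) => //; rewrite ltrDl.
move=> [N _ aN]; exists q, N; split=> // n Nn.
apply: le_trans (ak n) _; apply: ler_wpM2r => //; apply: kq.
(* A nonincreasing sequence stays above its limit, so a bound on the right of [limn a] is enough. *)
by rewrite nonincreasing_cvgn_ge//=; exact: aN.
Qed.

(** From index [N] on, the increments are dominated by a geometric sequence. The shifted sequence is
    thus, up to a constant, an absolutely convergent telescoping series, and [W] is complete. *)
Lemma contracting_increments_is_cvgn (R : realType) (W : completeNormedModType R)
  (x : W^nat) (q : R) (N : nat) : 0 <= q < 1 ->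
  (forall n, (N <= n)%N -> `|x n.+2 - x n.+1| <= q * `|x n.+1 - x n|) -> cvgn x.
Proof.
move=> /andP[q0 q1] xq; pose y := [sequence x (n + N)%N]_n.
have yq n : `|telescope y n| <= geometric `|x N.+1 - x N| q n.
  rewrite /telescope /y /geometric/=; elim: n => [|n IH].
    by rewrite expr0 mulr1.
  rewrite exprS mulrCA !addSn; apply: le_trans (xq _ (leq_addl _ _)) _.
  by rewrite ler_wpM2l.
have y_cvg : cvgn (series (telescope y)).
  apply: normed_cvg; apply: series_le_cvg yq _ => // [n|].
    by rewrite /geometric/= mulr_ge0// exprn_ge0.
  by apply: is_cvg_geometric_series; rewrite ger0_norm.
have : cvgn y.
  rewrite (_ : y = (fun n => y 0%N + series (telescope y) n)).
    by apply: is_cvgD => //; exact: is_cvg_cst.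
  by apply/funext => n; exact: eq_sum_telescope.
by rewrite /y => ycvg; apply/cvg_ex; exists (limn y); rewrite -(cvg_shiftn N).
Qed.

Lemma lower_semicontinuous_cvg_le0 (R : realType) (X : topologicalType)
  (h : X -> R) (x : X^nat) (l : X) :
  lower_semicontinuous (EFin \o h) -> x @ \oo --> l -> h (x n) @[n --> \oo] --> 0 ->
  h l <= 0.
Proof.
move=> h_lsc xl hx; rewrite leNgt; apply/negP => hl0.
(* If [h l > 0], the threshold [h l / 2] separates [h l] from 0: near [l] the values of [h] exceed
   it, while [h (x n)] eventually drops below it. *)
have [|V lV hV] := h_lsc l (h l / 2).
  by rewrite lte_fin ltr_pdivrMr// mulr_natr mulr2n ltrDl.
have hx_lt : \forall n \near \oo, h (x n) < h l / 2.
  by apply: (cvgr_lt 0) => //; rewrite divr_gt0.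
have [n [/hV + hn]] := filter_ex (filterI (xl _ lV : \forall n \near \oo, V (x n)) hx_lt).
by rewrite lte_fin ltNge (ltW hn).
Qed.

Theorem theorem3p3 (R : realType) (W : completeNormedModType R)
  (W0 : set W) (W0_subspace : GRing.submod_closed [in W0]) (W0_closed : closed W0)
  (T : W -> W) (T_range : range (fun w : W => w - T w) `<=` W0)
  (k : R -> R) (kU : U k)
  (T_contr : forall w : W, W0 (w - T w) ->
     `|T w - T (T w)| <= k `|w - T w| * `|w - T w|)
  (h_lsc : lower_semicontinuous (fun u : W => (`|u - T u|)%:E)) :
  forall w : W,
    cvgn (fun n : nat => iter n T w) /\
    limn (fun n : nat => iter n T w) \in
      [set x : W | x = T x] `&` [set w + x | x in W0].
Proof.
move=> w; pose x n := iter n T w.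
have TW0 u : W0 (u - T u) by apply: T_range; exists u.
have [q [N [q01 xq]]] := U_eventually_contracting kU
  (fun n => normr_ge0 (x n - x n.+1)) (fun n => T_contr (x n) (TW0 (x n))).
have x_cvg : cvgn x.
  apply: (contracting_increments_is_cvgn q01) => n /xq.
  by rewrite distrC [X in _ <= _ * X]distrC.
split=> //; rewrite inE; split=> /=.
  apply/eqP; rewrite -subr_eq0 -normr_le0.
  apply: (lower_semicontinuous_cvg_le0 h_lsc x_cvg).
  (* Since [T (x n)] is [x n.+1], both terms of the displacement tend to [limn x], so it tends to
     0. *)
  have x_cvgS : x n.+1 @[n --> \oo] --> limn x by rewrite cvg_shiftS.
  by rewrite -[X in _ --> X](normr0 W) -(subrr (limn x)); apply: cvg_norm; exact: cvgB.
have [W00 W0_lin] := W0_subspace.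
have xW0 n : W0 (x n - w).
  elim: n => [|n IH]; first by rewrite subrr; move: W00; rewrite inE.
  (* [x n.+1 - w] equals [- (x n - T (x n)) + (x n - w)], a combination of two elements of [W0]. *)
  have := W0_lin (-1) (x n - T (x n)) (x n - w).
  rewrite !inE => /(_ (TW0 _) IH).
  by rewrite scaleN1r opprB addrA subrK.
exists (limn x - w); last by rewrite addrC subrK.
have xwl : x n - w @[n --> \oo] --> limn x - w by apply: cvgB => //; exact: cvg_cst.
apply: (closed_cvg _ W0_closed _ _ xwl); exact: nearW.
Qed.
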